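(* Let $\mathcal A$ be a semiring system, $\mathcal M,\mathcal N$ be $\mathcal A$-systemic modules, $\pi:\mathcal M\to\mathcal N$ a homomorphism, and suppose that $\nu:\mathcal N\to\mathcal M$ $\preceq$-splits $\pi$ (resp. h-splits $\pi$). Then: (i) $\mathcal M$ is the $\preceq$-direct sum (resp. h-direct sum) of $\mathcal M_1:=\pi(\mathcal M)$ and $\mathcal M_2:=(1_{\mathcal M}(-)\nu\pi)(\mathcal M)$ with respect to the $\preceq$-morphisms (resp. homomorphisms) $\pi_1=\pi$, $\nu_1=\nu$, $\pi_2=1_{\mathcal M}(-)\nu\pi$, $\nu_2=1_{\mathcal M_2}$ (the identity map of $\mathcal M_2$, viewed as the inclusion $\mathcal M_2\to\mathcal M$). (ii) $\mathcal M$ is the $\preceq$-direct sum (resp. h-direct sum) of $\mathcal M_1=\nu\pi(\mathcal M)$ and $\mathcal M_2=\ker_{\mathrm{Mod},\mathcal M}\pi$, with respect to $\nu_i=1_{\mathcal M_i}$ (viewed as the inclusion $\mathcal M_i\to\mathcal M$) for $i=1,2$.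
   Context: Base definitions. Let $\mathcal T$ be a set. A $\mathcal T$-module is a commutative monoid $(\mathcal A,+,0)$ with a scalar multiplication $\mathcal T\times\mathcal A\to\mathcal A$ satisfying $a(\sum_j b_j)=\sum_j ab_j$ (finite sums) and $a0=0$. A negation map on it is a monoid isomorphism $(-):\mathcal A\to\mathcal A$ of order $\le 2$ with $(-)(ab)=a((-)b)$ for $a\in\mathcal T$, $b\in\mathcal A$. Write $b(-)c:=b+((-)c)$, $b^\circ:=b(-)b$, $\mathcal A^\circ:=\{b^\circ:b\in\mathcal A\}$. A pseudo-triple $(\mathcal A,\mathcal T_{\mathcal A},(-))$ is a $\mathcal T$-module with a negation map and a distinguished subset $\mathcal T_{\mathcal A}\subseteq\mathcal A$ (the tangible elements) with $(-)\mathcal T_{\mathcal A}=\mathcal T_{\mathcal A}$; it is a triple if moreover $\mathcal T_{\mathcal A}\cap\mathcal A^\circ=\emptyset$ and $\mathcal T_{\mathcal A}\cup\{0\}$ generates $(\mathcal A,+)$. A surpassing relation $\preceq$ is a pre-order on $\mathcal A$ such that: (i) $c^\circ\succeq 0$ for all $c$; (ii) $b_1\preceq b_2$ implies $(-)b_1\preceq(-)b_2$; (iii) $b_1\preceq b_2$ and $b_1'\preceq b_2'$ imply $b_1+b_1'\preceq b_2+b_2'$; (iv) $a\in\mathcal T$ and $b_1\preceq b_2$ imply $ab_1\preceq ab_2$; (v) $a\preceq b$ with $a,b\in\mathcal T_{\mathcal A}$ implies $a=b$. A system (resp. pseudo-system) $(\mathcal A,\mathcal T_{\mathcal A},(-),\preceq)$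 is a triple (resp. pseudo-triple) with a surpassing relation such that for each $a\in\mathcal T_{\mathcal A}$ there is a unique $b\in\mathcal T_{\mathcal A}$ with $0\preceq a+b$, namely $b=(-)a$. Put $\mathcal A_{\mathrm{Null}}=\{a\in\mathcal A:a\succeq 0\}$. Ground system and modules. $\mathcal A=(\mathcal A,\mathcal T,(-),\preceq)$ is a fixed semiring system: a system in which $\mathcal A$ is a semiring (with $0$ and $1$), with tangible set $\mathcal T\subseteq\mathcal A$ acting by multiplication. An $\mathcal A$-systemic module is a pseudo-system $(\mathcal M,\mathcal T_{\mathcal M},(-),\preceq)$ (with scalars $\mathcal T$) such that $\mathcal M$ is an $\mathcal A$-module, $\mathcal T_{\mathcal M}$ spans $\mathcal M$, $\mathcal T\mathcal T_{\mathcal M}\subseteq\mathcal T_{\mathcal M}$, $((-)a)m=(-)(am)$ for $a\in\mathcal A$, $m\in\mathcal M$, and $a_1b_1\preceq a_2b_2$ whenever $a_1\preceq a_2$ in $\mathcal A$ and $b_1\preceq b_2$ in $\mathcal M$. The symbol $\preceq$ is used for all surpassing relations. Submodules, images and kernels carry the restricted operations and relation. Morphisms. A $\preceq$-morphism $\varphi:\mathcal M\to\mathcal M'$ is a map with $\varphi(0)=0$, $\varphi((-)b)=(-)\varphi(b)$, $\varphi(b_1+b_2)\preceq\varphi(b_1)+\varphi(b_2)$, $\varphi(ab)=a\varphi(b)$ for $a\in\mathcal T$, and $b\preceq b'\Rightarrow\varphi(b)\preceq\varphi(b')$. A homomorphism is the same with equality $\varphi(b_1+b_2)=\varphi(b_1)+\varphi(b_2)$.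 For maps, $f\preceq g$ means $f(b)\preceq g(b)$ for all $b$; $f(-)g$ and $f+g$ are pointwise; $1_{\mathcal M}$ is the identity. Splitting. A $\preceq$-morphism $\nu:\mathcal N\to\mathcal M$ $\preceq$-splits $\pi:\mathcal M\to\mathcal N$ if $1_{\mathcal N}\preceq\pi\nu$; it h-splits $\pi$ if moreover $\nu$ is a homomorphism. Kernel. For a $\preceq$-morphism $f:\mathcal M\to\mathcal N$, a submodule $\mathcal M'\subseteq\mathcal M$ is $f$-null if $f(\mathcal M')\subseteq\mathcal N_{\mathrm{Null}}$; the null-module kernel $\ker_{\mathrm{Mod},\mathcal M}f$ is the sum of all $f$-null submodules of $\mathcal M$. Direct sums. $\mathcal M$ is the $\preceq$-direct sum of systemic modules $\mathcal M_i$, $i\in I$ ($I$ finite), if there are $\preceq$-morphisms $\pi_i:\mathcal M\to\mathcal M_i$ and $\preceq$-morphisms $\nu_i:\mathcal M_i\to\mathcal M$ that $\preceq$-split $\pi_i$, with $1_{\mathcal M}\preceq\sum_i\nu_i\pi_i$, $1_{\mathcal M_i}\preceq\pi_i\nu_i$ for all $i$, and $0\preceq\pi_j\nu_i$ for all $i\ne j$. The h-direct sum is defined identically with all $\pi_i,\nu_i$ homomorphisms.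
   Formalization: The summands M_i are not claimed to be systemic modules (false in general): they are subsets with restricted operations and relation, submodules in the h-case, but in the ⪯-case only containing 0 and stable under (-) and T, with addition used where defined or in the ambient module. *)

(* Defs.v *)
From mathcomp Require Import all_boot all_algebra.
From mathcomp Require Import classical_sets.

Set Implicit Arguments.
Unset Strict Implicit.
Unset Printing Implicit Defensive.

Import GRing.Theory.
Local Open Scope classical_set_scope.
Local Open Scope ring_scope.

Section SystemAxioms.
(* [T] is the set of scalars.  It always sits in a semiring [A] acting on [M],
   so the axioms of the action of [T] are those of the [A]-semimodule [M]. *)
Variables (A : pzSemiRingType) (T : set A) (M : lSemiModType A).
Variables (TM : set M) (neg : M -> M) (le : M -> M -> Prop).

Record is_negation_map : Prop := IsNegationMap {
  negation0 : neg 0 = 0;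
  negationD : forall b c, neg (b + c) = neg b + neg c;
  negationK : involutive neg;
  negationZ : forall a b, T a -> neg (a *: b) = a *: neg b }.

Record is_pseudo_triple : Prop := IsPseudoTriple {
  pseudo_triple_neg : is_negation_map;
  pseudo_triple_tangible : neg @` TM = TM }.

Record is_triple : Prop := IsTriple {
  triple_pseudo : is_pseudo_triple;
  triple_disjoint : TM `&` range (fun b => b + neg b) = set0;
  triple_generates : forall b : M, exists s : seq M,
    (forall c, c \in s -> TM c \/ c = 0) /\ b = \sum_(c <- s) c }.

Record is_surpassing : Prop := IsSurpassing {
  surpassing_refl : forall b, le b b;
  surpassing_trans : forall b c d, le b c -> le c d -> le b d;
  surpassing_circ : forall c, le 0 (c + neg c);
  surpassing_neg : forall b1 b2, le b1 b2 -> le (neg b1) (neg b2);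
  surpassing_add : forall b1 b2 b1' b2',
    le b1 b2 -> le b1' b2' -> le (b1 + b1') (b2 + b2');
  surpassing_scale : forall a b1 b2,
    T a -> le b1 b2 -> le (a *: b1) (a *: b2);
  surpassing_tangible : forall a b, TM a -> TM b -> le a b -> a = b }.

Definition unique_negation : Prop :=
  forall a, TM a -> unique (fun b => TM b /\ le 0 (a + b)) (neg a).

Record is_system : Prop := IsSystem {
  system_triple : is_triple;
  system_surpassing : is_surpassing;
  system_unique : unique_negation }.

Record is_pseudo_system : Prop := IsPseudoSystem {
  pseudo_system_triple : is_pseudo_triple;
  pseudo_system_surpassing : is_surpassing;
  pseudo_system_unique : unique_negation }.

End SystemAxioms.

Record semiring_system := SemiringSystem {
  sr_carrier :> pzSemiRingType;
  sr_tangible : set sr_carrier;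
  sr_neg : sr_carrier -> sr_carrier;
  sr_le : sr_carrier -> sr_carrier -> Prop;
  (* [sr_carrier^o] is the semiring seen as a left module over itself. *)
  sr_systemP :
    @is_system sr_carrier sr_tangible sr_carrier^o sr_tangible sr_neg sr_le }.

Record systemic_module (A : semiring_system) := SystemicModule {
  sm_carrier :> lSemiModType A;
  sm_tangible : set sm_carrier;
  sm_neg : sm_carrier -> sm_carrier;
  sm_le : sm_carrier -> sm_carrier -> Prop;
  sm_pseudo_systemP :
    is_pseudo_system (@sr_tangible A) sm_tangible sm_neg sm_le;
  sm_spans : forall b : sm_carrier, exists s : seq (A * sm_carrier),
    (forall p, p \in s -> sm_tangible p.2) /\ b = \sum_(p <- s) p.1 *: p.2;
  sm_tangibleZ : forall (a : A) (m : sm_carrier),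
    sr_tangible a -> sm_tangible m -> sm_tangible (a *: m);
  sm_negZ : forall (a : A) (m : sm_carrier), sr_neg a *: m = sm_neg (a *: m);
  sm_leZ : forall (a1 a2 : A) (b1 b2 : sm_carrier),
    sr_le a1 a2 -> sm_le b1 b2 -> sm_le (a1 *: b1) (a2 *: b2) }.

Notation "b <~ c" := (sm_le b c) (at level 70, no associativity) : ring_scope.

Section Maps.
Variable A : semiring_system.
Implicit Types M N : systemic_module A.

Definition sm_sub M (b c : M) : M := b + sm_neg c.

Definition map_le (X : Type) N (f g : X -> N) : Prop := forall x, f x <~ g x.
Definition map_sub (X : Type) N (f g : X -> N) : X -> N :=
  fun x => sm_sub (f x) (g x).

Definition null_part M : set M := [set b | 0 <~ b].

(* The image of a map that is only subadditive up to [<~] contains [0] and is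
   stable under negation and tangible scalars, but need not be stable under
   addition. *)
Record is_tangible_stable M (S : set M) : Prop := IsTangibleStable {
  stable0 : S 0;
  stableN : forall b, S b -> S (sm_neg b);
  stableZ : forall (a : A) b, sr_tangible a -> S b -> S (a *: b) }.

Record is_submodule M (S : set M) : Prop := IsSubmodule {
  submodule0 : S 0;
  submoduleN : forall b, S b -> S (sm_neg b);
  submoduleD : forall b c, S b -> S c -> S (b + c);
  submoduleZ : forall (a : A) b, S b -> S (a *: b) }.

(* Morphisms defined on a subset [S] of [M] carrying the restricted operations
   and relation: only the values of [f] on [S] matter, and the addition of [S]
   is that of [M] whenever the sum lies in [S]. *)
Record prec_morphism_on M N (S : set M) (f : M -> N) : Prop :=
  PrecMorphismOn {
  prec_morphism0 : f 0 = 0;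
  prec_morphismN : forall b, S b -> f (sm_neg b) = sm_neg (f b);
  prec_morphismD : forall b1 b2, S b1 -> S b2 -> S (b1 + b2) ->
    f (b1 + b2) <~ f b1 + f b2;
  prec_morphismZ : forall (a : A) b, sr_tangible a -> S b ->
    f (a *: b) = a *: f b;
  prec_morphism_le : forall b b', S b -> S b' -> b <~ b' -> f b <~ f b' }.

Record homomorphism_on M N (S : set M) (f : M -> N) : Prop :=
  HomomorphismOn {
  homomorphism_prec : prec_morphism_on S f;
  homomorphismD : forall b1 b2, S b1 -> S b2 -> S (b1 + b2) ->
    f (b1 + b2) = f b1 + f b2 }.

Definition prec_morphism M N (f : M -> N) : Prop :=
  prec_morphism_on [set: M] f.
Definition homomorphism M N (f : M -> N) : Prop :=
  homomorphism_on [set: M] f.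

Definition prec_splits M N (nu : N -> M) (pi : M -> N) : Prop :=
  prec_morphism nu /\ map_le id (pi \o nu).
Definition h_splits M N (nu : N -> M) (pi : M -> N) : Prop :=
  prec_splits nu pi /\ homomorphism nu.

Definition is_null_submodule M N (f : M -> N) (S : set M) : Prop :=
  is_submodule S /\ f @` S `<=` @null_part N.

(* The sum of all [f]-null submodules: finite sums of elements each taken from
   some [f]-null submodule. *)
Definition null_kernel M N (f : M -> N) : set M :=
  [set b | exists s : seq M,
    (forall c, c \in s -> exists2 S : set M, is_null_submodule f S & S c)
    /\ b = \sum_(c <- s) c].

Section DirectSum.
(* The [i]-th summand is the subset [S i] of the systemic module [P i], with the
   restricted operations and relation; sums of values of [pi i] are formed in
   [P i].  [S i := setT] gives a direct sum of the systemic modules [P i]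
   themselves.  An inclusion of [S i] into [M] is [nu i := id].  No tangible elements are attached to
   [S i]: no condition below involves them, and for [M] the square of
   {0, 1, e} with 1 + 1 = e, [pi] and [nu] the identity, no choice of tangible
   elements makes the image {0, e} x {0, e} of [1 (-) nu pi] a systemic
   module. *)
Variables (I : finType) (M : systemic_module A).
Variables (P : I -> systemic_module A) (S : forall i, set (P i)).
Variables (pi : forall i, M -> P i) (nu : forall i, P i -> M).

Record direct_sum_conditions : Prop := DirectSumConditions {
  direct_sum_into : forall i b, S (pi i b);
  direct_sum_cover : forall b, b <~ \sum_(i : I) nu (pi i b);
  direct_sum_split : forall i (b : P i), S b -> b <~ pi i (nu b);
  direct_sum_orth : forall i j (b : P i), i != j -> S b ->
    0 <~ pi j (nu b) }.

Record prec_direct_sum : Prop := PrecDirectSum {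
  prec_direct_sum_stable : forall i, is_tangible_stable (@S i);
  prec_direct_sum_pi : forall i, prec_morphism (pi i);
  prec_direct_sum_nu : forall i, prec_morphism_on (@S i) (@nu i);
  prec_direct_sumP : direct_sum_conditions }.

Record h_direct_sum : Prop := HDirectSum {
  h_direct_sum_submodule : forall i, is_submodule (@S i);
  h_direct_sum_pi : forall i, homomorphism (pi i);
  h_direct_sum_nu : forall i, homomorphism_on (@S i) (@nu i);
  h_direct_sumP : direct_sum_conditions }.

End DirectSum.

Section BinaryDirectSum.
Variables (M P1 P2 : systemic_module A).
Variables (S1 : set P1) (pi1 : M -> P1) (nu1 : P1 -> M).
Variables (S2 : set P2) (pi2 : M -> P2) (nu2 : P2 -> M).

Let P (i : bool) : systemic_module A := if i then P1 else P2.
Let S (i : bool) : set (P i) := if i as i return set (P i) then S1 else S2.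
Let pi (i : bool) : M -> P i := if i as i return M -> P i then pi1 else pi2.
Let nu (i : bool) : P i -> M := if i as i return P i -> M then nu1 else nu2.

Definition prec_direct_sum2 : Prop := prec_direct_sum S pi nu.
Definition h_direct_sum2 : Prop := h_direct_sum S pi nu.

End BinaryDirectSum.

End Maps.

(* Main.v *)
Require Import Defs.
From mathcomp Require Import all_boot all_algebra.
From mathcomp Require Import classical_sets.

(** Put [e := nu \o pi] and read [0 <~ b] as [b] being null.  The splitting
    [1 <~ pi \o nu] makes [e] idempotent up to [<~] in the weak sense that
    [b <~ e b] for every [b] in the image of [nu], and [1 (-) e] plays the part
    of the complementary projection.  Three observations carry the proof.

    - If [b <~ c] then [b (-) c] is null, because it surpasses [b (-) b]
      ([sm_sub_null]).  Applied to [b <~ e b] this says that [1 (-) e] is null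
      on the image of [nu]; applied to [pi b <~ pi (nu (pi b))] it says, [pi]
      being additive, that [pi] is null on the image of [1 (-) e].
    - Null elements can be added for free: [b <~ b + c] when [c] is null
      ([le_add_null]).  As [e b (-) e b] is null, this gives the covering
      [b <~ e b + (b (-) e b)]; as [e] preserves [<~] and [0], it gives the
      splitting [b <~ b (-) e b] whenever [pi b] is null
      ([le_compl_null]).
    - The null-module kernel of a homomorphism is just the set where it is null
      ([null_kernelE]), so the image of [1 (-) e] lies in it; its elements
      satisfy the same inequalities as those of that image, which is why one
      argument serves both decompositions, the second one with the
      projections [e] and [1 (-) e].

    What remains is that the maps involved are morphisms of the right kind and
    that the summands are stable.  In the h-case stability under all scalars,
    not only tangible ones, is needed: it follows from the fact that the tangible
    scalars and [0] additively generate the ground semiring, so that a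
    homomorphism is linear ([homomorphism_linear]). *)

Set Implicit Arguments.
Unset Strict Implicit.
Unset Printing Implicit Defensive.

Import GRing.Theory.
Local Open Scope classical_set_scope.
Local Open Scope ring_scope.

(** * Order and negation in a systemic module *)

Section SystemicModule.
Variables (A : semiring_system) (M : systemic_module A).
Implicit Types b c d : M.

Let negP : is_negation_map (@sr_tangible A) (@sm_neg A M) :=
  pseudo_triple_neg (pseudo_system_triple (sm_pseudo_systemP M)).
Let leP : is_surpassing (@sr_tangible A) (@sm_tangible A M) (@sm_neg A M)
    (@sm_le A M) :=
  pseudo_system_surpassing (sm_pseudo_systemP M).

Lemma sm_neg0 : sm_neg (0 : M) = 0.
Proof. exact: negation0 negP. Qed.

Lemma sm_negD b c : sm_neg (b + c) = sm_neg b + sm_neg c.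
Proof. exact: negationD negP b c. Qed.

Lemma sm_negZt (a : A) b : sr_tangible a -> sm_neg (a *: b) = a *: sm_neg b.
Proof. exact: negationZ negP a b. Qed.

Lemma sm_le_refl b : b <~ b.
Proof. exact: surpassing_refl leP b. Qed.

Lemma sm_le_trans c b d : b <~ c -> c <~ d -> b <~ d.
Proof. exact: surpassing_trans leP b c d. Qed.

Lemma sm_le_neg b c : b <~ c -> sm_neg b <~ sm_neg c.
Proof. exact: surpassing_neg leP b c. Qed.

Lemma sm_leD b c b' c' : b <~ c -> b' <~ c' -> b + b' <~ c + c'.
Proof. exact: surpassing_add leP b c b' c'. Qed.

Lemma sm_le_sub b c b' c' : b <~ c -> b' <~ c' -> sm_sub b b' <~ sm_sub c c'.
Proof. by move=> bc bc'; apply: sm_leD bc (sm_le_neg bc'). Qed.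

Lemma sm_subb_null b : 0 <~ sm_sub b b.
Proof. exact: surpassing_circ leP b. Qed.

Lemma sm_leZr (a : A) b c : b <~ c -> a *: b <~ a *: c.
Proof.
apply: sm_leZ.
exact: surpassing_refl (system_surpassing (sr_systemP A)) a.
Qed.

Lemma sm_sub_null b c : b <~ c -> 0 <~ sm_sub b c.
Proof.
move=> bc; apply: sm_le_trans (sm_subb_null b) _.
exact: sm_le_sub (sm_le_refl b) bc.
Qed.

Lemma null_neg b : 0 <~ b -> 0 <~ sm_neg b.
Proof. by move=> /sm_le_neg; rewrite sm_neg0. Qed.

Lemma le_add_null b c : 0 <~ c -> b <~ b + c.
Proof. by move=> c0; have := sm_leD (sm_le_refl b) c0; rewrite addr0. Qed.

(** Subtracting and adding back costs a quasi-zero [c (-) c], which is null. *)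
Lemma le_add_sub b c : b <~ c + sm_sub b c.
Proof.
by rewrite /sm_sub addrCA; apply: le_add_null; apply: sm_subb_null.
Qed.

Lemma tangible_sum (a : A) : exists s : seq A,
  (forall t, t \in s -> sr_tangible t \/ t = 0) /\ a = \sum_(t <- s) t.
Proof. exact: (triple_generates (system_triple (sr_systemP A)) a). Qed.

End SystemicModule.

(** * Morphisms and their images *)

Section Morphisms.
Variables (A : semiring_system) (M N P : systemic_module A).

Lemma prec_morphism_sub S (f : M -> N) :
  prec_morphism f -> prec_morphism_on S f.
Proof.
move=> hf; split.
- exact: prec_morphism0 hf.
- by move=> b _; apply: prec_morphismN hf _ I.
- by move=> b c _ _ _; apply: prec_morphismD hf _ _ I I I.
- by move=> a b ta _; apply: prec_morphismZ hf _ _ ta I.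
- by move=> b c _ _; apply: prec_morphism_le hf _ _ I I.
Qed.

Lemma homomorphism_sub S (f : M -> N) :
  homomorphism f -> homomorphism_on S f.
Proof.
move=> hf; split; first exact: prec_morphism_sub (homomorphism_prec hf).
by move=> b c _ _ _; apply: homomorphismD hf _ _ I I I.
Qed.

Lemma homomorphism_id : homomorphism (id : M -> M).
Proof. by split=> //; split=> // *; apply: sm_le_refl. Qed.

Lemma prec_morphism_comp (g : N -> P) (f : M -> N) :
  prec_morphism g -> prec_morphism f -> prec_morphism (g \o f).
Proof.
move=> hg hf; split=> /=.
- by rewrite (prec_morphism0 hf) (prec_morphism0 hg).
- by move=> b _; rewrite (prec_morphismN hf I) (prec_morphismN hg I).
- move=> b c _ _ _; apply: sm_le_trans (prec_morphismD hg I I I).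
  by apply: (prec_morphism_le hg I I); apply: prec_morphismD hf _ _ I I I.
- by move=> a b ta _; rewrite (prec_morphismZ hf ta I) (prec_morphismZ hg ta I).
- move=> b c _ _ bc; apply: (prec_morphism_le hg I I).
  exact: (prec_morphism_le hf I I bc).
Qed.

Lemma homomorphism_comp (g : N -> P) (f : M -> N) :
  homomorphism g -> homomorphism f -> homomorphism (g \o f).
Proof.
move=> hg hf; split.
  exact: prec_morphism_comp (homomorphism_prec hg) (homomorphism_prec hf).
by move=> b c _ _ _ /=; rewrite (homomorphismD hf I I I) (homomorphismD hg I I I).
Qed.

Lemma sm_subD (b c b' c' : N) :
  sm_sub (b + c) (b' + c') = sm_sub b b' + sm_sub c c'.
Proof. by rewrite /sm_sub sm_negD addrACA. Qed.

(** The negation preserves [<~] instead of reversing it; hence the difference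
    of two [<~]-morphisms is again monotone and subadditive up to [<~]. *)
Lemma prec_morphism_map_sub (f g : M -> N) :
  prec_morphism f -> prec_morphism g -> prec_morphism (map_sub f g).
Proof.
move=> hf hg; split; rewrite /map_sub.
- by rewrite (prec_morphism0 hf) (prec_morphism0 hg) /sm_sub sm_neg0 addr0.
- move=> b _; rewrite (prec_morphismN hf I) (prec_morphismN hg I).
  by rewrite /sm_sub sm_negD.
- move=> b c _ _ _; rewrite -sm_subD.
  exact: sm_le_sub (prec_morphismD hf I I I) (prec_morphismD hg I I I).
- move=> a b ta _; rewrite (prec_morphismZ hf ta I) (prec_morphismZ hg ta I).
  by rewrite /sm_sub scalerDr sm_negZt.
- move=> b c _ _ bc.
  exact: sm_le_sub (prec_morphism_le hf I I bc) (prec_morphism_le hg I I bc).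
Qed.

Lemma homomorphism_map_sub (f g : M -> N) :
  homomorphism f -> homomorphism g -> homomorphism (map_sub f g).
Proof.
move=> hf hg; split.
  exact: prec_morphism_map_sub (homomorphism_prec hf) (homomorphism_prec hg).
move=> b c _ _ _; rewrite /map_sub (homomorphismD hf I I I).
by rewrite (homomorphismD hg I I I) sm_subD.
Qed.

(** Every scalar is a finite sum of tangible scalars and zeros, and both sides
    are additive in the scalar. *)
Lemma homomorphism_linear (f : M -> N) (hf : homomorphism f) (a : A) b :
  f (a *: b) = a *: f b.
Proof.
have f0 : f 0 = 0 := prec_morphism0 (homomorphism_prec hf).
have [s [ts ->]] := tangible_sum a; elim: s ts => [|t s IHs] ts.
  by rewrite big_nil !scale0r.
rewrite big_cons !scalerDl (homomorphismD hf I I I) IHs; last first.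
  by move=> u us; apply: ts; rewrite inE us orbT.
congr (_ + _); have [tt|->] := ts t (mem_head t s).
  exact: (prec_morphismZ (homomorphism_prec hf) tt I).
by rewrite !scale0r.
Qed.

Lemma range_tangible_stable (f : M -> N) :
  prec_morphism f -> is_tangible_stable (range f).
Proof.
move=> hf; split.
- by exists 0 => //; apply: prec_morphism0 hf.
- by move=> _ [b _ <-]; exists (sm_neg b) => //; apply: prec_morphismN hf _ I.
- move=> a _ ta [b _ <-]; exists (a *: b) => //.
  exact: (prec_morphismZ hf ta I).
Qed.

Lemma range_submodule (f : M -> N) : homomorphism f -> is_submodule (range f).
Proof.
move=> hf; have [s0 sN _] := range_tangible_stable (homomorphism_prec hf).
split=> //.
- move=> _ _ [b _ <-] [c _ <-]; exists (b + c) => //.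
  exact: (homomorphismD hf I I I).
- move=> a _ [b _ <-]; exists (a *: b) => //.
  exact: homomorphism_linear.
Qed.

Lemma submodule_tangible_stable (S : set M) :
  is_submodule S -> is_tangible_stable S.
Proof. by case=> s0 sN _ sZ; split=> // a b _; apply: sZ. Qed.

End Morphisms.

(** * The null-module kernel of a homomorphism *)

Section NullKernel.
Variables (A : semiring_system) (M N : systemic_module A).
Variables (f : M -> N) (hf : homomorphism f).

Lemma null_preimage_submodule : is_submodule [set b | 0 <~ f b].
Proof.
have hpf := homomorphism_prec hf; split=> /=.
- by rewrite (prec_morphism0 hpf); apply: sm_le_refl.
- by move=> b fb; rewrite (prec_morphismN hpf I); apply: null_neg.
- move=> b c fb fc; rewrite (homomorphismD hf I I I).
  exact: sm_le_trans fb (le_add_null _ fc).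
- move=> a b fb; rewrite (homomorphism_linear hf) -(scaler0 N a).
  exact: sm_leZr.
Qed.

(** For an additive [f] the set on the right is itself an [f]-null submodule,
    hence the largest one, and it absorbs the sums that define the kernel. *)
Lemma null_kernelE : null_kernel f = [set b | 0 <~ f b].
Proof.
have sK := null_preimage_submodule; apply/seteqP; split=> b /=.
  move=> [s [hs ->]]; elim: s hs => [|c s IHs] hs.
    by rewrite big_nil; apply: submodule0 sK.
  rewrite big_cons; apply: (submoduleD sK).
    have [S [_ Snull] Sc] := hs c (mem_head c s).
    by apply: Snull; exists c.
  by apply: IHs => d ds; apply: hs; rewrite inE ds orbT.
move=> fb; exists [:: b]; split; last by rewrite big_seq1.
move=> c; rewrite inE => /eqP ->; exists [set b' | 0 <~ f b'] => //.
by split=> // _ [d fd <-].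
Qed.

End NullKernel.

(** * Direct sums with two summands *)

Section TwoSummands.
Variables (A : semiring_system) (M P1 P2 : systemic_module A).
Variables (S1 : set P1) (pi1 : M -> P1) (nu1 : P1 -> M).
Variables (S2 : set P2) (pi2 : M -> P2) (nu2 : P2 -> M).

(** The conditions of a direct sum indexed by [bool], unfolded so that the two
    summands can be treated without dependent case analysis. *)
Record direct_sum_conditions2 : Prop := DirectSumConditions2 {
  direct_sum2_into1 : forall b, S1 (pi1 b);
  direct_sum2_into2 : forall b, S2 (pi2 b);
  direct_sum2_cover : forall b, b <~ nu1 (pi1 b) + nu2 (pi2 b);
  direct_sum2_split1 : forall b, S1 b -> b <~ pi1 (nu1 b);
  direct_sum2_split2 : forall b, S2 b -> b <~ pi2 (nu2 b);
  direct_sum2_orth12 : forall b, S1 b -> 0 <~ pi2 (nu1 b);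
  direct_sum2_orth21 : forall b, S2 b -> 0 <~ pi1 (nu2 b) }.

Lemma prec_direct_sum2I :
  is_tangible_stable S1 -> is_tangible_stable S2 ->
  prec_morphism pi1 -> prec_morphism pi2 ->
  prec_morphism nu1 -> prec_morphism nu2 ->
  direct_sum_conditions2 -> prec_direct_sum2 S1 pi1 nu1 S2 pi2 nu2.
Proof.
move=> s1 s2 p1 p2 n1 n2 [i1 i2 cover sp1 sp2 o12 o21]; split.
- by case.
- by case.
- by case; apply: prec_morphism_sub.
- split; [by case| |by case|].
    by move=> b; rewrite big_bool; apply: cover.
  by case; case=> // b _; [apply: o12 | apply: o21].
Qed.

Lemma h_direct_sum2I :
  is_submodule S1 -> is_submodule S2 ->
  homomorphism pi1 -> homomorphism pi2 ->
  homomorphism nu1 -> homomorphism nu2 ->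
  direct_sum_conditions2 -> h_direct_sum2 S1 pi1 nu1 S2 pi2 nu2.
Proof.
move=> s1 s2 p1 p2 n1 n2 hc; split; [by case|by case| |].
  by case; apply: homomorphism_sub.
suff : prec_direct_sum2 S1 pi1 nu1 S2 pi2 nu2 by apply: prec_direct_sumP.
apply: prec_direct_sum2I hc;
  by [exact: submodule_tangible_stable | exact: homomorphism_prec].
Qed.

End TwoSummands.

(** * The decompositions defined by a splitting *)

Section Splitting.
Variables (A : semiring_system) (M N : systemic_module A).
Variables (pi : M -> N) (nu : N -> M).
Hypotheses (hpi : homomorphism pi) (hsplit : prec_splits nu pi).

Local Notation e := (nu \o pi).
Local Notation compl := (map_sub id (nu \o pi)).

Let ppi : prec_morphism pi := homomorphism_prec hpi.
Let pnu : prec_morphism nu := hsplit.1.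
Let splitP b : b <~ pi (nu b) := hsplit.2 b.

Lemma le_splitting_image y : nu y <~ e (nu y).
Proof. exact: (prec_morphism_le pnu I I (splitP y)). Qed.

(** Additivity of [pi] turns [pi (x (-) e x)] into [pi x (-) pi (nu (pi x))],
    where the subtracted element surpasses [pi x]. *)
Lemma compl_null x : 0 <~ pi (compl x).
Proof.
rewrite /map_sub /sm_sub (homomorphismD hpi I I I) (prec_morphismN ppi I).
exact: sm_sub_null (splitP (pi x)).
Qed.

Lemma splitting_null b : 0 <~ pi b -> 0 <~ e b.
Proof.
move=> pib; rewrite -(prec_morphism0 pnu).
exact: (prec_morphism_le pnu I I pib).
Qed.

Lemma le_compl_null b : 0 <~ pi b -> b <~ compl b.
Proof. by move=> pib; apply/le_add_null/null_neg/splitting_null. Qed.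

Lemma compl_splitting_null y : 0 <~ compl (nu y).
Proof. exact: sm_sub_null (le_splitting_image y). Qed.

Lemma image_conditions :
  direct_sum_conditions2 (range pi) pi nu (range compl) compl id.
Proof.
split.
- by move=> b; exists b.
- by move=> b; exists b.
- by move=> b; apply: le_add_sub.
- by move=> b _; apply: splitP.
- by move=> _ [x _ <-]; apply/le_compl_null/compl_null.
- by move=> b _; apply: compl_splitting_null.
- by move=> _ [x _ <-]; apply: compl_null.
Qed.

Lemma kernel_conditions :
  direct_sum_conditions2 (range e) e id (null_kernel pi) compl id.
Proof.
rewrite null_kernelE //; split.
- by move=> b; exists b.
- exact: compl_null.
- by move=> b; apply: le_add_sub.
- by move=> _ [x _ <-]; apply: le_splitting_image.
- exact: le_compl_null.
- by move=> _ [x _ <-]; apply: compl_splitting_null.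
- exact: splitting_null.
Qed.

End Splitting.

Local Close Scope ring_scope.
Unset Implicit Arguments.

Theorem theoremA (A : semiring_system) (M N : systemic_module A)
    (pi : M -> N) (nu : N -> M) (hpi : homomorphism pi) :
  (prec_splits nu pi ->
     prec_direct_sum2
       (range pi) pi nu
       (range (map_sub id (nu \o pi))) (map_sub id (nu \o pi)) id
     /\ exists pi1 pi2 : M -> M,
          prec_direct_sum2 (range (nu \o pi)) pi1 id (null_kernel pi) pi2 id)
  /\
  (h_splits nu pi ->
     h_direct_sum2
       (range pi) pi nu
       (range (map_sub id (nu \o pi))) (map_sub id (nu \o pi)) id
     /\ exists pi1 pi2 : M -> M,
          h_direct_sum2 (range (nu \o pi)) pi1 id (null_kernel pi) pi2 id).
Proof.
have ppi := homomorphism_prec hpi.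
have hid := homomorphism_id M; have pid := homomorphism_prec hid.
have sK : is_submodule (null_kernel pi).
  by rewrite null_kernelE //; apply: null_preimage_submodule.
split=> [hs | [hs hnu]].
- have [pnu _] := hs.
  have pe := prec_morphism_comp pnu ppi.
  have pc := prec_morphism_map_sub pid pe.
  split.
    apply: prec_direct_sum2I => //; first exact: range_tangible_stable.
      exact: range_tangible_stable.
    exact: image_conditions.
  exists (nu \o pi), (map_sub id (nu \o pi)).
  apply: prec_direct_sum2I => //; first exact: range_tangible_stable.
    exact: submodule_tangible_stable.
  exact: kernel_conditions.
- have he := homomorphism_comp hnu hpi.
  have hc := homomorphism_map_sub hid he.
  split.
    apply: h_direct_sum2I => //; first exact: range_submodule.
      exact: range_submodule.
    exact: image_conditions.
  exists (nu \o pi), (map_sub id (nu \o pi)).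
  apply: h_direct_sum2I => //; first exact: range_submodule.
  exact: kernel_conditions.
Qed.
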